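(* Let $\Omega\subseteq\mathbb{R}^m$, let $F(\Omega)$ be a Banach space of functions $f:\Omega\to\mathbb{C}$ with norm $\|\cdot\|_{F(\Omega)}$, let $B$ be a closed subspace of $F(\Omega)$, and let $D:B\to F(\Omega)$ be a bounded linear operator. Let $a\in\Omega$ and let $G=G(a)$ be a compact topological group of continuous transformations $s:\Omega\to\Omega$ with fixed point $a$, i.e. $sa=a$ for all $s\in G$. Assume: (C1) for every $f\in F(\Omega)$ and each $s\in G$, $\|f(s\cdot)\|_{F(\Omega)}=\|f\|_{F(\Omega)}$; (C2) for every $f\in B$ and each $s\in G$, $D(f_s)(\cdot)=D(f)(s\cdot)$, where $f_s(\cdot):=f(s\cdot)$; (C3) for every $f\in B$ and each $s\in G$, $f(s\cdot)\in B$; (C4) for every $f\in B$ the mapping $s\mapsto f(s\cdot)$ from $G$ to $B$ is continuous, i.e. for any $s\in G$, $\lim_{\tau\to s}\|f(s\cdot)-f(\tau\cdot)\|_{F(\Omega)}=0$; (C5) $B\cap F(\Omega)^{G}\neq\{0\}$. Then $$\mathcal{C}_a\left(B,F(\Omega),D\right)=\mathcal{C}_a\left(B\cap F(\Omega)^{G},F(\Omega),D\right).$$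
   Context: $F(\Omega)^{G}$ denotes the subspace of $F(\Omega)$ of all functions $f$ invariant under $G$, i.e. $f(s\cdot)=f(\cdot)$ for all $s\in G$. For a closed subspace $\mathcal{B}\neq\{0\}$ of $F(\Omega)$ on which the bounded linear operator $D$ into $F(\Omega)$ is defined, and $a\in\Omega$, the sharp constant is $$\mathcal{C}_a(\mathcal{B},F(\Omega),D):=\sup_{f\in\mathcal{B}\setminus\{0\}}\frac{|D(f)(a)|}{\|f\|_{F(\Omega)}}.$$
   Formalization: The formal theorem additionally assumes that the sharp constant C_a(B,F(Ω),D) is finite; this is automatic when evaluation at a is continuous on F(Ω), and without it the stated equality can fail. *)

(* Defs.v *)
From HB Require Import structures.
From mathcomp Require Import all_boot all_order all_algebra.
From mathcomp Require Import all_classical all_reals all_analysis.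
From mathcomp Require Import complex.

Set Implicit Arguments.
Unset Strict Implicit.
Unset Printing Implicit Defensive.

Import Order.TTheory GRing.Theory Num.Theory.
Import numFieldNormedType.Exports.

Local Open Scope classical_set_scope.
Local Open Scope complex_scope.
Local Open Scope ring_scope.

HB.mixin Record isTopologicalGroup G of Topological G & Group G := {
  mulg_continuous : continuous (fun st : G * G => (st.1 * st.2)%g) ;
  invg_continuous : continuous (fun s : G => (s^-1)%g)
}.

(* No separation axiom is imposed. *)
#[short(type="topologicalGroupType")]
HB.structure Definition TopologicalGroup :=
  {G of Topological G & Group G & isTopologicalGroup G}.

(* The norm of a normedZmodType over R[i] takes values in R[i] (on the
   nonnegative real axis); [rnorm] is the same number as an element of R. *)
Definition rnorm (R : realType) (V : normedZmodType R[i]) (v : V) : R :=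
  complex.Re `|v|.

(* A complex Banach space of functions T -> C: a Banach space together with a
   linear injection [fval] into T -> R[i], by which its elements are identified
   with functions; the function g lies in the space when [range (fval F) g]. *)
Record banachFunctionSpace (R : realType) (T : Type) := BanachFunctionSpace {
  bfs_carrier :> completeNormedModType R[i] ;
  fval : bfs_carrier -> T -> R[i] ;
  fval_linear : forall (k : R[i]) (f g : bfs_carrier) (x : T),
    fval (k *: f + g) x = k * fval f x + fval g x ;
  fval_inj : injective fval
}.

Section FunctionSpace.
Context (R : realType) (T : Type) (F : banachFunctionSpace R T).
Implicit Types (f g : F) (s : T -> T) (B : set F) (D : F -> F).

(* The element f(s .) of F. It is unique by [fval_inj]; the default value 0 is
   only taken when the function f(s .) is not in F. *)
Definition precomp f s : F := xget 0 [set g | fval g = fval f \o s].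

Definition closed_subspace B : Prop :=
  [/\ closed B, B 0 &
      forall (k : R[i]) f g, B f -> B g -> B (k *: f + g)].

(* An operator D : B -> F is represented by a total function F -> F of which
   only the values on B are ever constrained or used. *)
Definition bounded_linear_on B D : Prop :=
  (forall (k : R[i]) f g, B f -> B g -> D (k *: f + g) = k *: D f + D g) /\
  (exists M : R, forall f, B f -> rnorm (D f) <= M * rnorm f).

Definition invariant_functions (G : Type) (tr : G -> T -> T) : set F :=
  [set f | forall s : G, fval f \o tr s = fval f].

Definition sharp_constant (a : T) B D : \bar R :=
  ereal_sup [set (rnorm (fval (D f) a) / rnorm f)%:E | f in B `\ 0].

End FunctionSpace.
Arguments fval {R T} b _ _.
Arguments invariant_functions {R T} F {G} tr.

(* [tr] realizes the elements of G as pairwise distinct continuous maps X -> X,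
   the group law being composition. *)
Definition continuous_transformation_group (X : topologicalType)
    (G : topologicalGroupType) (tr : G -> X -> X) : Prop :=
  [/\ injective tr,
      forall s : G, continuous (tr s),
      tr 1%g = id &
      forall s t : G, tr (s * t)%g = tr s \o tr t].

(* Main.v *)
(* Write f_s for f(s .).  The means of finitely many f_s lie in B, have norm at
   most |f|, and D(.)(a) takes the value D(f)(a) on them since s a = a.  It is
   therefore enough to find a G-invariant h in the closure of these means: then
   D(h)(a) = D(f)(a) by continuity of D(.)(a) on B, and |h| <= |f|.
   No Haar measure is needed.  Let d bound |h_s - h| over s for a mean h, and
   let N orbit points of h form an e-net of its orbit: their mean h' satisfies
   |h'_s - h'| <= ((N - 1) d + e) / N.  By compactness of G, N can be chosen
   depending on f and e only, not on the mean h; so the oscillation of means can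
   be made arbitrarily small.  Taking means of means, with oscillations tending
   to 0, produces a Cauchy sequence whose limit is invariant. *)
Require Import Defs.
From HB Require Import structures.
From mathcomp Require Import all_boot all_order all_algebra.
From mathcomp Require Import all_classical all_reals all_analysis.
From mathcomp Require Import complex.
From mathcomp Require Import ring lra.

Set Implicit Arguments.
Unset Strict Implicit.
Unset Printing Implicit Defensive.

Import Order.TTheory GRing.Theory Num.Theory.
Import numFieldNormedType.Exports.

Local Open Scope classical_set_scope.
Local Open Scope complex_scope.
Local Open Scope ring_scope.

Lemma sumr_const_seq (M : nmodType) (I : Type) (l : seq I) (x : M) :
  \sum_(i <- l) x = x *+ size l.
Proof. by rewrite big_const_seq count_predT iter_addr_0. Qed.

(** * The norm as a real number *)

Section RealNorm.
Context (R : realType) (V : normedZmodType R[i]).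
Implicit Types u v w : V.

Lemma normrE_rnorm v : `|v| = (rnorm v)%:C.
Proof. by rewrite /rnorm RRe_real. Qed.

Lemma rnorm_ge0 v : 0 <= rnorm v.
Proof. by rewrite -lecR -normrE_rnorm normr_ge0. Qed.

Lemma rnormD u v : rnorm (u + v) <= rnorm u + rnorm v.
Proof. by rewrite -lecR rmorphD/= -!normrE_rnorm ler_normD. Qed.

Lemma rnormB u v : rnorm (u - v) <= rnorm u + rnorm v.
Proof. by rewrite -lecR rmorphD/= -!normrE_rnorm ler_normB. Qed.

Lemma rdistC u v : rnorm (u - v) = rnorm (v - u).
Proof. by rewrite /rnorm distrC. Qed.

Lemma rnorm0 : rnorm (0 : V) = 0.
Proof. by rewrite /rnorm normr0. Qed.

Lemma rnorm_eq0 v : rnorm v = 0 -> v = 0.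
Proof. by move=> v0; apply/normr0_eq0; rewrite normrE_rnorm v0. Qed.

Lemma rdistD w u v : rnorm (u - v) <= rnorm (u - w) + rnorm (w - v).
Proof. by rewrite (le_trans _ (rnormD _ _))// subrKA. Qed.

Lemma rnorm_sum (I : Type) (l : seq I) (x : I -> V) :
  rnorm (\sum_(i <- l) x i) <= \sum_(i <- l) rnorm (x i).
Proof.
elim/big_rec2: _ => [|i y z _ yz]; first by rewrite rnorm0.
by rewrite (le_trans (rnormD _ _))// lerD2l.
Qed.

End RealNorm.

(** * Means and neighbourhoods in a normed module *)

Section NormedModule.
Context (R : realType) (V : normedModType R[i]).
Implicit Types (v : V) (e : R[i]).

Lemma rnormZn (n : nat) v : rnorm (n%:R^-1 *: v) = n%:R^-1 * rnorm v.
Proof.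
apply: complexI; rewrite -normrE_rnorm normrZ normfV normr_nat normrE_rnorm.
by rewrite rmorphM/= fmorphV/= rmorph_nat.
Qed.

Lemma rnorm_mean (I : Type) (l : seq I) (x : I -> V) v : (0 < size l)%N ->
  rnorm ((size l)%:R^-1 *: \sum_(i <- l) x i - v) <=
  (size l)%:R^-1 * \sum_(i <- l) rnorm (x i - v).
Proof.
move=> l0; have {1}-> : v = (size l)%:R^-1 *: \sum_(i <- l) v.
  rewrite sumr_const_seq -[v *+ _]scaler_nat scalerA mulVf ?scale1r//.
  by rewrite pnatr_eq0 -lt0n.
rewrite -scalerBr -sumrB rnormZn ler_wpM2l ?invr_ge0//.
exact: rnorm_sum.
Qed.

Lemma mean_le (I : Type) (l : seq I) (x : I -> R) (c : R) : (0 < size l)%N ->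
  (forall i, x i <= c) -> (size l)%:R^-1 * \sum_(i <- l) x i <= c.
Proof.
move=> l0 xc; rewrite ler_pdivrMl ?ltr0n// mulr_natl -sumr_const_seq.
exact: ler_sum.
Qed.

Lemma ltc_normE v e : 0 < e -> (`|v| < e) = (rnorm v < complex.Re e).
Proof. by move=> e0; rewrite -ltcR -normrE_rnorm RRe_real// gtr0_real. Qed.

Lemma nbhs_rball v (d : R) : 0 < d -> \forall u \near v, rnorm (v - u) < d.
Proof.
move=> d0; near=> u.
have -> : d = complex.Re d%:C by [].
rewrite -ltc_normE ?ltcR//.
near: u; apply: cvgr_dist_lt; first exact: cvg_id.
by rewrite ltcR.
Unshelve. all: by end_near. Qed.

Lemma closure_rnorm (S : set V) v :
  (forall d : R, 0 < d -> exists2 u, S u & rnorm (v - u) < d) -> closure S v.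
Proof.
move=> Sv A /nbhs_ballP[e /= e0 eA].
have [|u Su uv] := Sv (complex.Re e).
  by move: e0; rewrite ltcE => /andP[].
by exists u; split=> //; apply: eA; rewrite -ball_normE /= ltc_normE.
Qed.

End NormedModule.

(** Otherwise the sets of points missed by finite subfamilies generate a proper filter; at a cluster
    point [x] of it, the neighbourhood [E x] would meet its own complement. *)
Lemma compact_finite_subcover (T : topologicalType) (E : T -> set T) :
  compact [set: T] -> (forall x, nbhs x (E x)) ->
  exists l : seq T, forall y, exists2 x, x \in l & E x y.
Proof.
move=> cT nE; apply: contrapT => noCover.
pose Fs : set_system T := [set A |
  exists l : seq T, forall y, (forall x, x \in l -> ~ E x y) -> A y].
have FF : ProperFilter Fs.
  split; last split.
  - move=> [l ln]; apply: noCover; exists l => y.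
    by apply: contrapT => ny; apply: (ln y) => x xl Exy; apply: ny; exists x.
  - by exists [::].
  - move=> A A' [l lA] [l' lA']; exists (l ++ l') => y yl; split.
      by apply: lA => x xl; apply: yl; rewrite mem_cat xl.
    by apply: lA' => x xl; apply: yl; rewrite mem_cat xl orbT.
  - by move=> A A' AA' [l lA]; exists l => y /lA /AA'.
have [x [_ /(_ (~` E x) (E x))]] := cT Fs FF (@filterT _ _ FF).
case=> //; last by move=> y [].
by exists [:: x] => y /(_ x (mem_head _ _)).
Qed.

(** * Means over orbits of a compact group acting by isometries *)

Section InvariantElement.
Context (R : realType) (V : completeNormedModType R[i]).
Context (G : topologicalGroupType) (T : G -> V -> V) (B : set V).
Hypothesis G_compact : compact [set: G].
Hypothesis T_linear : forall s k f g, T s (k *: f + g) = k *: T s f + T s g.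
Hypothesis T_isometry : forall s f, rnorm (T s f) = rnorm f.
Hypothesis T1 : forall f, T 1%g f = f.
(** The order is that of precomposition, (f o t) o s = f o (t s): a right action. *)
Hypothesis TM : forall s t f, T s (T t f) = T (t * s)%g f.
Hypothesis B0 : B 0.
Hypothesis B_linear : forall k f g, B f -> B g -> B (k *: f + g).
Hypothesis B_stable : forall s f, B f -> B (T s f).
Hypothesis T_continuous : forall f, B f -> continuous (T^~ f).

(** A list lets group elements repeat, so that a mean of means is again of this form. On the empty
    list the value is 0. *)
Definition average (l : seq G) (f : V) : V :=
  (size l)%:R^-1 *: \sum_(s <- l) T s f.

Definition osc_le (f : V) (d : R) : Prop := forall s, rnorm (T s f - f) <= d.

Lemma action0 s : T s 0 = 0.
Proof.
have := T_linear s 1 0 0; rewrite !scale1r addr0 => /esym/eqP.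
by rewrite -subr_eq0 addrK => /eqP.
Qed.

Lemma actionD s f g : T s (f + g) = T s f + T s g.
Proof. by have := T_linear s 1 f g; rewrite !scale1r. Qed.

Lemma actionZ s k f : T s (k *: f) = k *: T s f.
Proof. by have := T_linear s k f 0; rewrite action0 !addr0. Qed.

Lemma actionB s f g : T s (f - g) = T s f - T s g.
Proof. by rewrite actionD -scaleN1r actionZ scaleN1r. Qed.

Lemma action_dist s f g : rnorm (T s f - T s g) = rnorm (f - g).
Proof. by rewrite -actionB T_isometry. Qed.

Lemma action_sum s (I : Type) (l : seq I) (x : I -> V) :
  T s (\sum_(i <- l) x i) = \sum_(i <- l) T s (x i).
Proof. by elim/big_rec2: _ => [|i y z _ <-]; rewrite ?action0 ?actionD. Qed.

Lemma action_average s l f :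
  T s (average l f) = (size l)%:R^-1 *: \sum_(t <- l) T (t * s)%g f.
Proof. by rewrite actionZ action_sum; under eq_bigr do rewrite TM. Qed.

Lemma average_average l l' f :
  average l' (average l f) = average [seq (t * s)%g | s <- l', t <- l] f.
Proof.
rewrite /average size_allpairs natrM invfM -scalerA big_allpairs_dep /=.
congr (_ *: _); rewrite [RHS]scaler_sumr; apply: eq_bigr => s _.
exact: action_average.
Qed.

Lemma average_le l f g d : (0 < size l)%N ->
  (forall s, rnorm (T s f - g) <= d) -> rnorm (average l f - g) <= d.
Proof. by move=> l0 fgd; rewrite (le_trans (rnorm_mean _ _ l0))// mean_le. Qed.

Lemma sum_in_subspace (I : Type) (l : seq I) (x : I -> V) :
  (forall i, B (x i)) -> B (\sum_(i <- l) x i).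
Proof.
move=> Bx; elim/big_ind: _ => // f g Bf Bg.
by rewrite -[f]scale1r; apply: B_linear.
Qed.

Lemma average_in l f : B f -> B (average l f).
Proof.
move=> Bf; rewrite /average -[_ *: _]addr0; apply: B_linear => //.
by apply: sum_in_subspace => s; apply: B_stable.
Qed.

Lemma osc_le_dist f d s t : osc_le f d -> rnorm (T s f - T t f) <= d.
Proof.
move=> /(_ (s * t^-1)%g).
by rewrite -(action_dist t) TM mulgVK.
Qed.

(* One of the [size l] terms of the mean is at distance at most [e] from the
   given orbit point, the others are at distance at most [d]. *)
Lemma average_osc l f d e :
  (forall s, exists2 t, t \in l & rnorm (T s f - T t f) <= e) ->
  osc_le f d ->
  osc_le (average l f) ((size l)%:R^-1 * ((size l).-1%:R * d + e)).
Proof.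
move=> netl fd.
have l0 : (0 < size l)%N by have [t] := netl 1%g; case: (l).
have near_orbit s : rnorm (T s f - average l f) <=
    (size l)%:R^-1 * ((size l).-1%:R * d + e).
  rewrite rdistC (le_trans (rnorm_mean _ _ l0))// ler_wpM2l ?invr_ge0//.
  have [t tl ste] := netl s.
  rewrite (big_rem t)//= addrC lerD//; last by rewrite rdistC.
  rewrite -(size_rem tl) mulr_natl -sumr_const_seq.
  by apply: ler_sum => u _; apply: osc_le_dist.
move=> s; rewrite action_average (le_trans (rnorm_mean _ _ l0))//.
by apply: mean_le => // t; apply: near_orbit.
Qed.

Lemma orbit_net f e : B f -> 0 < e ->
  exists l : seq G, forall s, exists2 t, t \in l & rnorm (T t f - T s f) < e.
Proof.
move=> Bf e0; apply: compact_finite_subcover => // s.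
exact: (T_continuous Bf (nbhs_rball _ e0)).
Qed.

(** Take a finite e/3-net of the orbit, indexed by [l1]. Near each [s], the maps sending [s] to
    [T s (T v f)], for the finitely many [v] in [l1], all vary by less than e/3; compactness of [G]
    leaves finitely many such neighbourhoods. Uniformity in [u] lets one list serve every mean of
    [f]. *)
Lemma uniform_orbit_net f e : B f -> 0 < e ->
  exists l : seq G, forall s, exists2 t, t \in l &
    forall u, rnorm (T (u * s)%g f - T (u * t)%g f) <= e.
Proof.
move=> Bf e0; have e30 : 0 < e / 3 by rewrite divr_gt0.
have [l1 netl1] := orbit_net Bf e30.
have nE s : \forall s' \near s,
    forall v, v \in l1 -> rnorm (T s (T v f) - T s' (T v f)) < e / 3.
  elim: l1 {netl1} => [|v l1 IH]; first by apply: nearW.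
  have := T_continuous (B_stable v Bf) (nbhs_rball (T s (T v f)) e30).
  move=> near_v; near=> s' => w; rewrite in_cons => /predU1P[->|].
    by near: s'.
  by move: w; near: s'.
have [l netl] := compact_finite_subcover G_compact nE.
exists l => s; have [t tl st] := netl s; exists t => // u.
have [v vl1 vu] := netl1 u.
(* The path goes through [T s (T v f)] and [T t (T v f)]; by isometry both outer legs have the
   length of [T v f - T u f]. *)
rewrite -!TM (le_trans (rdistD (T s (T v f)) _ _))//.
have := rdistD (T t (T v f)) (T s (T v f)) (T t (T u f)).
rewrite !action_dist [rnorm (T s _ - T t (T v f))]rdistC [rnorm (T u f - _)]rdistC.
by move: (st _ vl1) vu; lra.
Unshelve. all: by end_near. Qed.

(** Pairing the terms at [u * s] and [u * t] carries the uniform net of [f] over to all its means,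
    with the same list. *)
Lemma average_dist_le l f s t d : (0 < size l)%N ->
  (forall u, rnorm (T (u * s)%g f - T (u * t)%g f) <= d) ->
  rnorm (T s (average l f) - T t (average l f)) <= d.
Proof.
move=> l0 std; rewrite !action_average -scalerBr -sumrB -[_ *: _]subr0.
rewrite (le_trans (rnorm_mean _ _ l0))//; apply: mean_le => // u.
by rewrite subr0.
Qed.

(** If the infimum [m] of the oscillation bounds of means were at least [e], averaging an almost
    optimal mean over a net of precision [m / 2] would produce a bound below [m]. *)
Lemma average_osc_small f e : B f -> 0 < e ->
  exists2 l : seq G, (0 < size l)%N & osc_le (average l f) e.
Proof.
move=> Bf e0.
pose E := [set d | exists2 l : seq G, (0 < size l)%N & osc_le (average l f) d].
have E_inf : has_inf E.
  split; last by exists 0 => d [l _ /(_ 1%g)]; apply/le_trans/rnorm_ge0.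
  exists (rnorm (average [:: 1%g] f) + rnorm (average [:: 1%g] f)).
  exists [:: 1%g] => // s.
  by rewrite (le_trans (rnormB _ _))// T_isometry.
have [infE_lt|e_le] := ltP (inf E) e.
  have [|d [l l0 ld] dlt] := @inf_adherent _ E (e - inf E) _ E_inf.
    by rewrite subr_gt0.
  by exists l => // s; rewrite (le_trans (ld s))//; lra.
exfalso; set m := inf E in e_le; have m0 : 0 < m by exact: lt_le_trans e_le.
have m20 : 0 < m / 2 by rewrite divr_gt0.
have [l0 netl0] := uniform_orbit_net Bf m20.
have N0 : (0 < size l0)%N by have [t] := netl0 1%g; case: (l0).
set N : R := (size l0)%:R.
have N_gt0 : 0 < N by rewrite ltr0n.
(* The slack gives N d < N m + m/2. Since d >= m, it follows that (N - 1) d + m/2 < N m. *)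
have [|d [l ln ld] dlt] := @inf_adherent _ E (m / (2 * N)) _ E_inf.
  by rewrite divr_gt0// mulr_gt0.
have net_avg s : exists2 t, t \in l0 &
    rnorm (T s (average l f) - T t (average l f)) <= m / 2.
  by have [t tl0 st] := netl0 s; exists t => //; apply: average_dist_le.
(* As a single mean of [f], the new mean has its oscillation bound in [E]. *)
have := average_osc net_avg ld; rewrite average_average => osc_new.
suff : m <= N^-1 * ((size l0).-1%:R * d + m / 2).
  apply/negP; rewrite -ltNge ltr_pdivrMl//.
  have -> : (size l0).-1%:R = N - 1 :> R by rewrite -subn1 natrB.
  have N1 : 1 <= N by rewrite ler1n.
  have dN : d * N < m * N + m / 2.
    have -> : m * N + m / 2 = (m + m / (2 * N)) * N by field; lra.
    by rewrite ltr_pM2r.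
  have md : m <= d by apply: ge_inf; [case: E_inf | exists l].
  lra.
apply: ge_inf; first by case: E_inf.
by eexists; [|exact: osc_new]; rewrite size_allpairs muln_gt0 N0.
Qed.

(* Each term of the sequence is an average of the previous ones, so it stays
   within their oscillation: the averages of small oscillation are Cauchy. *)
Theorem exists_invariant_average f : B f ->
  exists2 h, forall s, T s h = h &
    forall e, 0 < e -> exists2 l : seq G, (0 < size l)%N &
      rnorm (h - average l f) < e.
Proof.
move=> Bf.
(* The pair holds the stage n and the current vector; the oscillation asked for is 1/(n+1). Outside
   [B] the list [[::]] is a dummy value. *)
have /choice[step stepP] (p : nat * V) : exists l : seq G, B p.2 ->
    (0 < size l)%N /\ osc_le (average l p.2) p.1.+1%:R^-1.
  case: p => n g /=; have [Bg|] := pselect (B g); last by exists [::].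
  have [|l l0 lg] := @average_osc_small g n.+1%:R^-1 Bg; first by rewrite invr_gt0.
  by exists l.
pose fix g n := if n is k.+1 then average (step (k, g k)) (g k) else f.
have Bg n : B (g n) by elim: n => //= n; apply: average_in.
(* For [k = 0] the mean is the one-term mean at the identity. *)
have g_avg n k : exists2 l, (0 < size l)%N & g (n + k)%N = average l (g n).
  elim: k => [|k [l l0 gl]].
    by exists [:: 1%g] => //; rewrite addn0 /average big_seq1 T1 invr1 scale1r.
  rewrite addnS /=; set l' := step _.
  have l'0 : (0 < size l')%N by have [] := stepP ((n + k)%N, g (n + k)%N) (Bg _).
  exists [seq (t * s)%g | s <- l', t <- l]; last by rewrite gl average_average.
  by rewrite size_allpairs muln_gt0 l'0.
have osc_g n : osc_le (g n.+1) n.+1%:R^-1.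
  by have [] := stepP (n, g n) (Bg n).
have g_dist n k : (n < k)%N -> rnorm (g n.+1 - g k) <= n.+1%:R^-1.
  move=> nk; have [l l0] := g_avg n.+1 (k - n.+1)%N; rewrite subnKC// => ->.
  by rewrite rdistC; apply: average_le => // s; apply: osc_g.
have inv_small e : 0 < e -> \forall n \near \oo, n.+1%:R^-1 < e :> R.
  by move=> e0; apply: (near_infty_natSinv_lt (PosNum e0)).
have /cauchy_cvgP/cvg_ex[h gh] : cauchy (g @ \oo).
  apply: cauchy_exP => e e0.
  have [|n _ nP] := inv_small (complex.Re e).
    by move: e0; rewrite ltcE => /andP[].
  exists (g n.+1); exists n.+1 => // k /= nk.
  rewrite -ball_normE /= ltc_normE// (le_lt_trans (g_dist _ _ nk))//.
  exact: nP n (leqnn n).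
have g_near e : 0 < e -> \forall n \near \oo, rnorm (h - g n) < e.
  by move=> e0; apply: (gh _ (nbhs_rball _ e0)).
exists h => [s|e e0].
  (* Compare [T s h] with [h] through [T s k] and [k], for a late term [k] of the sequence. Its
     index is a successor because [osc_g] bounds the oscillation of [g n.+1]. *)
  apply/subr0_eq/rnorm_eq0/le_anti; rewrite rnorm_ge0 andbT.
  apply/ler_addgt0Pl => e e0; rewrite addr0.
  have e30 : 0 < e / 3 by rewrite divr_gt0.
  have [n1 _ n1P] := g_near _ e30.
  have [n2 _ n2P] := inv_small _ e30.
  have hg := n1P (maxn n1 n2).+1 (leqW (leq_maxl _ _)).
  have ge : rnorm (T s (g (maxn n1 n2).+1) - g (maxn n1 n2).+1) < e / 3.
    by rewrite (le_lt_trans (osc_g _ _))//; apply: n2P; exact: leq_maxr.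
  move: hg ge; set k := g _ => hg ge.
  have := rdistD (T s k) (T s h) h; have := rdistD k (T s k) h.
  by rewrite action_dist (rdistC k) /= in hg *; lra.
have [n _ nP] := g_near e e0.
have [l l0 gl] := g_avg 0%N n; exists l => //.
by rewrite -gl add0n; apply: nP => /=.
Qed.

End InvariantElement.

(** * Symmetrization and equality of the sharp constants *)

Theorem theorem2p1 (R : realType) (m : nat) (Omega : set 'rV[R]_m)
    (F : banachFunctionSpace R Omega)
    (B : set F) (hB : closed_subspace B)
    (D : F -> F) (hD : bounded_linear_on B D)
    (a : Omega)
    (G : topologicalGroupType) (hG : compact [set: G])
    (tr : G -> Omega -> Omega) (htr : continuous_transformation_group tr)
    (hfix : forall s : G, tr s a = a)
    (C1 : forall (f : F) (s : G),
        range (fval F) (fval F f \o tr s) /\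
        rnorm (precomp f (tr s)) = rnorm f)
    (C2 : forall (f : F) (s : G), B f ->
        fval F (D (precomp f (tr s))) = fval F (D f) \o tr s)
    (C3 : forall (f : F) (s : G), B f -> B (precomp f (tr s)))
    (C4 : forall f : F, B f -> continuous (fun s : G => precomp f (tr s)))
    (C5 : B `&` invariant_functions F tr <> [set 0])
    (* f |-> D(f)(a) is bounded on B: without it the equality can fail *)
    (hfin : (sharp_constant a B D < +oo)%E) :
  sharp_constant a B D = sharp_constant a (B `&` invariant_functions F tr) D.
Proof.
have [B_closed B0 B_linear] := hB.
have [D_linear _] := hD.
have [_ _ tr1 trM] := htr.
pose T (s : G) (f : F) : F := precomp f (tr s).
(* By [C1] the function f(s .) lies in [F], so [precomp] never takes its default value 0. *)
have fvalT s f : fval F (T s f) = fval F f \o tr s.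
  have [[g _ fg] _] := C1 f s.
  exact: (xgetPex 0 (ex_intro [set g | fval F g = fval F f \o tr s] g fg)).
have T_linear s k f g : T s (k *: f + g) = k *: T s f + T s g.
  apply: fval_inj; apply/funext => x.
  by rewrite fval_linear !fvalT /= fval_linear.
have T_isometry s f : rnorm (T s f) = rnorm f by have [] := C1 f s.
have T1 f : T 1%g f = f by apply: fval_inj; rewrite fvalT tr1.
have TM s t f : T s (T t f) = T (t * s)%g f.
  by apply: fval_inj; rewrite !fvalT trM.
pose L f := fval F (D f) a.
have L_linear k f g : B f -> B g -> L (k *: f + g) = k * L f + L g.
  by move=> Bf Bg; rewrite /L D_linear// fval_linear.
have L0 : L 0 = 0.
  have := L_linear 1 0 0 B0 B0; rewrite scale1r mul1r addr0 => /esym/eqP.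
  by rewrite -subr_eq0 addrK => /eqP.
have L_invariant s f : B f -> L (T s f) = L f.
  by move=> Bf; rewrite /L C2//= hfix.
have ratio_le f : B f -> f <> 0 ->
    ((rnorm (L f) / rnorm f)%:E <= sharp_constant a B D)%E.
  by move=> Bf f0; apply: ereal_sup_ubound; exists f.
have rnorm_gt0 (f : F) : f <> 0 -> 0 < rnorm f.
  move=> f0; rewrite lt_neqAle rnorm_ge0 andbT eq_sym.
  by apply/eqP => /rnorm_eq0.
(* The finite sharp constant is itself a bound for [L]; adding 1 makes [M] positive, so that one can
   divide by it. *)
have [M M0 L_bounded] : exists2 M : R, 0 < M &
    forall f, B f -> rnorm (L f) <= M * rnorm f.
  exists (`|fine (sharp_constant a B D)| + 1); first by rewrite ltr_wpDl.
  move=> f Bf; have [->|/eqP f0] := eqVneq f 0.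
    by rewrite L0 !rnorm0 mulr0.
  rewrite -ler_pdivrMr ?rnorm_gt0//.
  move: (ratio_le f Bf f0) hfin.
  case: (sharp_constant a B D) => [r| |]//=; rewrite lee_fin => fr _.
  by rewrite (le_trans fr)// (le_trans (ler_norm r))// lerDl.
have L_average l f : (0 < size l)%N -> B f -> L (average T l f) = L f.
  move=> l0 Bf.
  have L_sum (l' : seq G) : L (\sum_(s <- l') T s f) = L f *+ size l'.
    elim: l' => [|s l' IH]; first by rewrite big_nil L0.
    rewrite big_cons -[T s f]scale1r L_linear; first last.
    - by apply: sum_in_subspace => // t; apply: C3.
    - exact: C3.
    by rewrite mul1r IH L_invariant// mulrS.
  rewrite /average -[_ *: _]addr0 L_linear//; last first.
    by apply: sum_in_subspace => // t; apply: C3.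
  rewrite L_sum L0 addr0 -[L f *+ _]mulr_natl mulKf//.
  by rewrite pnatr_eq0 -lt0n.
have symmetrize f : B f -> exists h,
    [/\ (B `&` invariant_functions F tr) h, L h = L f & rnorm h <= rnorm f].
  move=> Bf.
  have [h Th h_avg] := exists_invariant_average hG T_linear T_isometry T1 TM
    B0 B_linear (fun s f => @C3 f s) C4 Bf.
  have Bavg l : B (average T l f) by apply: average_in => // s g; apply: C3.
  have Bh : B h.
    apply/B_closed/closure_rnorm => d d0; have [l _ hl] := h_avg d d0.
    by exists (average T l f).
  exists h; split.
  - by split=> // s; rewrite -fvalT Th.
  - apply/subr0_eq/rnorm_eq0/le_anti; rewrite rnorm_ge0 andbT.
    apply/ler_addgt0Pl => d d0; rewrite addr0.
    (* [L] takes the value [L f] on the mean, so [L h] differs from [L f] by at most M (d / M) =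
       d. *)
    have [l l0 hl] := h_avg (d / M) (divr_gt0 d0 M0).
    rewrite -(L_average l f)//.
    have -> : L h - L (average T l f) = L (- 1 *: average T l f + h).
      by rewrite L_linear// mulN1r addrC.
    rewrite scaleN1r addrC (le_trans (L_bounded _ _))//.
      by rewrite addrC -scaleN1r; apply: B_linear.
    by rewrite mulrC -ler_pdivlMr// ltW.
  - apply/ler_addgt0Pl => d d0; have [l l0 hl] := h_avg d d0.
    rewrite -[h](subrK (average T l f)) (le_trans (rnormD _ _))// lerD//.
      exact: ltW.
    rewrite -[average T l f]subr0; apply: average_le => // s.
    by rewrite subr0 T_isometry.
apply/le_anti/andP; split; last first.
  by apply: le_ereal_sup => _ [f [[Bf _] f0] <-]; exists f.
have C_ge f : (B `&` invariant_functions F tr) f -> f <> 0 ->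
    ((rnorm (L f) / rnorm f)%:E <=
      sharp_constant a (B `&` invariant_functions F tr) D)%E.
  by move=> If f0; apply: ereal_sup_ubound; exists f.
apply: ge_ereal_sup => _ [f [Bf f0] <-]; rewrite -/(L f).
(* When [L f = 0] the symmetrized element may vanish. Only nonnegativity of the right-hand constant
   is then to be shown, and any nonzero invariant element from [C5] gives it. *)
have [Lf0|/eqP Lf0] := eqVneq (L f) 0.
  rewrite Lf0 rnorm0 mul0r.
  have [g Ig g0] : exists2 g, (B `&` invariant_functions F tr) g & g <> 0.
    apply: contrapT => noInv; apply: C5; apply/seteqP; split => [g Ig|_ ->].
      by apply: contrapT => g0; apply: noInv; exists g.
    split=> // s; apply/funext => x /=.
    have fval0 y : fval F 0 y = 0.
      have := fval_linear 1 (0 : F) 0 y; rewrite scaler0 addr0 mul1r.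
      by move/esym/eqP; rewrite -subr_eq0 addrK => /eqP.
    by rewrite !fval0.
  by rewrite (le_trans _ (C_ge g Ig g0))// lee_fin divr_ge0// rnorm_ge0.
(* Here [h] is nonzero because [L h = L f] is; with the same value at [a] and no larger norm, its
   ratio is at least that of [f]. *)
have [h [Ih Lh hf]] := symmetrize f Bf.
have h0 : h <> 0 by move=> h0; apply: Lf0; rewrite -Lh h0.
rewrite (le_trans _ (C_ge h Ih h0))// lee_fin Lh ler_wpM2l ?rnorm_ge0//.
by rewrite lef_pV2 ?posrE ?rnorm_gt0.
Qed.
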